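(* Let $C_S(2):=8\sqrt{2\pi(e+256)}$ and $A(t)=e^{t^2}-1$. For every mesh size vector $h=(h_1,h_2)$, $$\|u\|_A\le C_S(2)\|u\|_{W^{1,2}}\quad\text{for all }u\in W^{1,2}(\mathbb{R}^2_h),$$ which is equivalent to $\sum_{x\in\mathbb{R}^2_h}A\big(\frac{|u(x)|}{C_S(2)\|u\|_{W^{1,2}}}\big)\mathbf{h}\le1$ for all $u\in W^{1,2}(\mathbb{R}^2_h)\setminus\{0\}$. In particular, $\|u\|_{L^p}\le 2C_S(2)\,p\,\|u\|_{W^{1,2}}$ for all $u\in W^{1,2}(\mathbb{R}^2_h)$ and all $p\ge2$.
   Context: $h_1,h_2>0$, $\mathbb{R}^2_h=\{(h_1z_1,h_2z_2):z_i\in\mathbb{Z}\}$, $\mathbf{h}=h_1h_2$, $D_i^+u(x)=(u(x+h_ie_i)-u(x))/h_i$. $\|u\|_{L^p}=(\sum_{x\in\mathbb{R}^2_h}|u(x)|^p\mathbf{h})^{1/p}$, $\|u\|_{W^{1,2}}^2=\sum_{x}|u(x)|^2\mathbf{h}+\sum_{i=1}^2\sum_x|D_i^+u(x)|^2\mathbf{h}$ (sums over $\mathbb{R}^2_h$), $W^{1,2}(\mathbb{R}^2_h)=\{u:\|u\|_{W^{1,2}}<\infty\}$. The Orlicz norm is $\|u\|_A=\inf\{k>0:\sum_{x\in\mathbb{R}^2_h}A(|u(x)|/k)\mathbf{h}\le1\}$. *)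

(* Defs.v *)
From HB Require Import structures.
From mathcomp Require Import all_boot all_order all_algebra.
From mathcomp Require Import all_classical all_reals all_analysis.
Set Implicit Arguments. Unset Strict Implicit. Unset Printing Implicit Defensive.
Import Order.TTheory GRing.Theory Num.Theory.
Local Open Scope classical_set_scope.
Local Open Scope ring_scope.

(* A grid function on R^2_h is represented by u : int * int -> R, where
   u (z1, z2) is the value at the grid point (h1 z1, h2 z2). *)

Section Grid.
Variable R : realType.
Variables h1 h2 : R.

Definition hvol : R := h1 * h2.

Definition D1p (u : int * int -> R) (z : int * int) : R :=
  (u (z.1 + 1, z.2)%R - u z) / h1.
Definition D2p (u : int * int -> R) (z : int * int) : R :=
  (u (z.1, z.2 + 1)%R - u z) / h2.

(* sum over the lattice of a nonnegative quantity (extended-real valued) *)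
Definition gsum (f : int * int -> R) : \bar R :=
  \esum_(z in [set: int * int]) (f z)%:E.

Definition W12sq (u : int * int -> R) : \bar R :=
  (gsum (fun z => ((u z) ^+ 2 * hvol)%R)
   + gsum (fun z => ((D1p u z) ^+ 2 * hvol)%R)
   + gsum (fun z => ((D2p u z) ^+ 2 * hvol)%R))%E.

Definition inW12 (u : int * int -> R) : Prop := (W12sq u < +oo)%E.

Definition W12norm (u : int * int -> R) : R := Num.sqrt (fine (W12sq u)).

Definition Lpnorm (p : R) (u : int * int -> R) : \bar R :=
  ((gsum (fun z => (powR `|u z| p * hvol)%R)) `^ (p^-1)%R)%E.

(* Orlicz norm for a Young function A (inf of the empty set is +oo) *)
Definition orlicz_norm (A : R -> R) (u : int * int -> R) : \bar R :=
  ereal_inf [set k%:E | k in [set k : R | 0 < k /\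
     (gsum (fun z => (A (`|u z| / k) * hvol)%R) <= 1)%E]].

End Grid.

Definition Aexp {R : realType} (t : R) : R := expR (t ^+ 2) - 1.

Definition CS2 {R : realType} : R :=
  8 * Num.sqrt (2 * pi * (expR 1 + 256)).

(* Main.v *)
Require Import Defs.
From HB Require Import structures.
From mathcomp Require Import all_boot all_order all_algebra.
From mathcomp Require Import all_classical all_reals all_analysis.
From mathcomp Require Import ring lra zify.
Set Implicit Arguments. Unset Strict Implicit. Unset Printing Implicit Defensive.
Import Order.TTheory GRing.Theory Num.Theory.
Local Open Scope classical_set_scope.
Local Open Scope ring_scope.

(** Normalise [v = |u| / ||u||_{W^{1,2}}] and let [a t] be the volume of
    [{v >= t}].  Cut [v] between the levels [s] and [2 s] into [k] truncations
    [T_m] of height [d = s / k], with Dirichlet energies [E_m].  The discrete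
    Gagliardo inequality [sum f^2 <= ||D1 f||_1 ||D2 f||_1] applied to [T_m],
    combined with Cauchy-Schwarz on the support of its gradient, gives
    [d^2 a (s + (m+1) d) <= a (s + m d) E_m].  Since the energies add up to at
    most [1], multiplying these inequalities and using AM-GM yields
    [a (2 s) <= a s * (k / s^2)^k], independently of the mesh.  With
    [s = 4 * 2^m] and [k = 4^m] this beats the growth of [exp (v^2 / c)] on every
    dyadic layer as soon as [c >= 256].  The [L^p] bound follows from the
    pointwise inequality [w^p <= (2 p)^p (exp (w^2) - 1)].

    All the estimates are made on finite boxes [{0..n}^2], large enough that
    [v] is at most [4] on the two faces through the origin of the box. *)

Section Box.
Variable R : realType.
Implicit Types (f v : nat -> nat -> R) (n k : nat) (r s t d : R).

(** * Gagliardo inequality on a box *)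

Definition var1 n f : R := \sum_(i < n) \sum_(j < n.+1) `|f i.+1 j - f i j|.
Definition energy1 n f : R := \sum_(i < n) \sum_(j < n.+1) (f i.+1 j - f i j) ^+ 2.
(** Quantities in the second direction are those of the flipped function, so each directional
    estimate is proved once. *)
Definition flip f := fun i j => f j i.
Definition box_count n v (t : R) : R := \sum_(i < n.+1) \sum_(j < n.+1) ((t <= v i j)%R)%:R.

Lemma le_column_variation n f (i j : nat) : f 0%N j = 0 -> (i < n.+1)%N ->
  `|f i j| <= \sum_(k < n) `|f k.+1 j - f k j|.
Proof.
move=> f0 ilen.
have -> : f i j = \sum_(0 <= k < i) (f k.+1 j - f k j).
  by rewrite (telescope_sumr (fun k => f k j)) // f0 subr0.
apply: (le_trans (ler_norm_sum _ _ _)).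
rewrite -(big_mkord xpredT (fun k => `|f k.+1 j - f k j|)).
rewrite [leRHS](big_cat_nat (n:=i)) //= lerDl.
by apply: sumr_ge0.
Qed.

(** Each [f i j] is bounded both by a variation depending only on [j] and by one depending only on
    [i]; the double sum of the product of these two bounds factorizes. *)
Lemma gagliardo_box n f : (forall j, f 0%N j = 0) -> (forall i, f i 0%N = 0) ->
  \sum_(i < n.+1) \sum_(j < n.+1) f i j ^+ 2 <= var1 n f * var1 n (flip f).
Proof.
move=> f0 f0'.
rewrite /var1 [X in _ <= X * _]exchange_big /= [X in _ <= _ * X]exchange_big /= mulrC mulr_suml.
apply: ler_sum => i _; rewrite mulr_sumr; apply: ler_sum => j _.
rewrite -real_normK ?num_real// expr2 [leRHS]mulrC.
apply: ler_pM => //; first exact: (le_column_variation (f0 j) (ltn_ord i)).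
exact: (@le_column_variation n (flip f) _ _ (f0' i) (ltn_ord j)).
Qed.

(** Both sides expand into double sums, compared term by term: [x i * x j] is at most half of
    [b i * x j ^+ 2 + b j * x i ^+ 2]. *)
Lemma cauchy_schwarz_support (I : finType) (x : I -> R) (b : pred I) :
  (forall i, x i != 0 -> b i) ->
  (\sum_i x i) ^+ 2 <= (\sum_i (b i)%:R) * \sum_i x i ^+ 2.
Proof.
move=> xb.
have -> : (\sum_i x i) ^+ 2 = \sum_i \sum_j x i * x j.
  by rewrite expr2 mulr_suml; apply: eq_bigr => i _; rewrite mulr_sumr.
set S := _ * _.
have -> : S = \sum_i \sum_j ((b i)%:R * x j ^+ 2 + (b j)%:R * x i ^+ 2) / 2.
  transitivity ((S + S) / 2); first by lra.
  have e1 : S = \sum_i \sum_j (b i)%:R * x j ^+ 2.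
    by rewrite /S mulr_suml; apply: eq_bigr => i _; rewrite mulr_sumr.
  rewrite {1}e1 [in X in _ + X]e1 [in X in _ + X]exchange_big /= -big_split /= mulr_suml.
  apply: eq_bigr => i _; rewrite -big_split /= mulr_suml.
  by apply: eq_bigr => j _.
apply: ler_sum => i _; apply: ler_sum => j _.
have [xi0|/xb ->] := eqVneq (x i) 0.
  by rewrite xi0 mul0r expr0n /= mulr0 addr0; apply: divr_ge0 => //; apply: mulr_ge0 => //; apply: sqr_ge0.
have [xj0|/xb ->] := eqVneq (x j) 0.
  by rewrite xj0 mulr0 expr0n /= mulr0 add0r; apply: divr_ge0 => //; apply: mulr_ge0 => //; apply: sqr_ge0.
rewrite !mul1r; have := sqr_ge0 (x i - x j); lra.
Qed.

(** * Truncations between two levels *)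

Definition trunc (t d x : R) : R := Num.min (Num.max (x - t) 0) d.

Lemma trunc_ge0 (t d x : R) : 0 <= d -> 0 <= trunc t d x.
Proof. by move=> d0; rewrite /trunc le_min d0 le_max lexx orbT. Qed.

Lemma trunc_eq0 (t d x : R) : 0 <= d -> x <= t -> trunc t d x = 0.
Proof.
move=> d0 xt; rewrite /trunc; have -> : Num.max (x - t) 0 = 0 by apply/max_idPr; lra.
exact/min_idPl.
Qed.

Lemma trunc_mono (t d x y : R) : x <= y -> trunc t d x <= trunc t d y.
Proof.
move=> xy; rewrite /trunc le_min; apply/andP; split; last by rewrite ge_min lexx orbT.
rewrite ge_min; apply/orP; left.
by rewrite ge_max !le_max lexx orbT lerD2r xy.
Qed.

Lemma truncD (t d e x : R) : 0 <= d -> 0 <= e ->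
  trunc t (d + e) x = trunc t d x + trunc (t + d) e x.
Proof.
move=> d0 e0; rewrite /trunc /Num.max; do ?[case: ltP => ?]; rewrite /Num.min;
  do ?[case: ltP => ?]; lra.
Qed.

Lemma trunc_lip (t d x y : R) : 0 <= d -> (trunc t d x - trunc t d y) ^+ 2 <= (x - y) ^+ 2.
Proof.
move=> d0; wlog xy : x y / y <= x => [H|].
  have [|/ltW] := leP y x; first exact: H.
  by move=> /H; rewrite -sqrrN opprB -[X in _ <= X]sqrrN opprB.
have := @trunc_mono t d _ _ xy; rewrite -subr_ge0 => h.
rewrite lerXn2r ?nnegrE ?subr_ge0 //; first by rewrite -subr_ge0.
suff : trunc t d x <= trunc t d y + (x - y) by lra.
rewrite /trunc; have [hy|hy] := leP (y - t) 0; last first.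
  have [hd|hd] := leP d (y - t).
    by rewrite ge_min; apply/orP; right; lra.
  by rewrite ge_min; apply/orP; left; rewrite ge_max; apply/andP; split; lra.
rewrite (min_idPl d0) ge_min; apply/orP; left.
by rewrite ge_max; apply/andP; split; lra.
Qed.

(** Consecutive truncations add up to a single one, and their increments share the sign of [x - y];
    hence the sum of squares is at most the square of the sum, and [trunc_lip] concludes. *)
Lemma sum_trunc_lip (s d x y : R) k : 0 <= d ->
  \sum_(m < k) (trunc (s + m%:R * d) d x - trunc (s + m%:R * d) d y) ^+ 2 <= (x - y) ^+ 2.
Proof.
move=> d0; apply: le_trans (@trunc_lip s (k%:R * d) x y _); last exact: mulr_ge0.
elim: k => [|k IH]; first by rewrite big_ord0 sqr_ge0.
rewrite big_ord_recr /= -natr1 mulrDl mul1r !truncD ?mulr_ge0 //.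
apply: (le_trans (lerD IH (lexx _))).
set a := trunc s _ x; set b := trunc s _ y; set a' := trunc _ _ x; set b' := trunc _ _ y.
suff : 0 <= (a - b) * (a' - b') by nra.
have [xy|/ltW xy] := leP x y.
  by apply: mulr_le0; rewrite subr_le0; apply: trunc_mono.
by apply: mulr_ge0; rewrite subr_ge0; apply: trunc_mono.
Qed.

(** * Decay of the superlevel counts *)

Lemma energy1_ge0 n f : 0 <= energy1 n f.
Proof. by apply: sumr_ge0 => i _; apply: sumr_ge0 => j _; rewrite sqr_ge0. Qed.

Lemma var1_ge0 n f : 0 <= var1 n f.
Proof. by apply: sumr_ge0 => i _; apply: sumr_ge0. Qed.

Lemma box_count_ge0 n v t : 0 <= box_count n v t.
Proof. by apply: sumr_ge0 => i _; apply: sumr_ge0 => j _; rewrite ler0n. Qed.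

Lemma box_count_flip n v t : box_count n (flip v) t = box_count n v t.
Proof. by rewrite /box_count exchange_big. Qed.

(** An edge with both ends below [t] has zero increment. The factor 2 arises because a point of the
    superlevel set is an end of at most two edges in one direction. *)
Lemma var1_trunc n v t d : 0 <= d ->
  var1 n (fun i j => trunc t d (v i j)) ^+ 2 <=
  (2 * box_count n v t) * energy1 n (fun i j => trunc t d (v i j)).
Proof.
move=> d0; rewrite /var1 /energy1 !pair_bigA /=.
set F := fun p : 'I_n * 'I_n.+1 => trunc t d (v p.1.+1 p.2) - trunc t d (v p.1 p.2).
pose b := fun p : 'I_n * 'I_n.+1 => (t <= v p.1.+1 p.2) || (t <= v p.1 p.2).
have := @cauchy_schwarz_support _ (fun p => `|F p|) b.
move=> /(_ _)/le_trans; apply.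
  move=> p; rewrite normr_eq0; apply: contraNT.
  rewrite negb_or -!ltNge => /andP[h1 h2].
  by rewrite /F (trunc_eq0 d0 (ltW h1)) (trunc_eq0 d0 (ltW h2)) subrr.
under [X in _ * X <= _]eq_bigr do rewrite real_normK ?num_real//.
apply: ler_wpM2r; first by apply: sumr_ge0 => p _; rewrite sqr_ge0.
have c1 : \sum_(i < n) \sum_(j < n.+1) ((t <= v i.+1 j)%R)%:R <= box_count n v t.
  by rewrite /box_count [leRHS]big_ord_recl lerDr sumr_ge0 // => j _; rewrite ler0n.
have c2 : \sum_(i < n) \sum_(j < n.+1) ((t <= v i j)%R)%:R <= box_count n v t.
  by rewrite /box_count [leRHS]big_ord_recr lerDl sumr_ge0 // => j _; rewrite ler0n.
rewrite mulr_natl mulr2n; apply: le_trans (lerD c1 c2).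
rewrite !pair_bigA /= -big_split /=; apply: ler_sum => p _; rewrite /b.
by case: (t <= v p.1.+1 p.2); case: (t <= v p.1 p.2) => /=; lra.
Qed.

(* With [r = h2 / h1] this is the Dirichlet energy of the grid function, the cell
   volume [h1 h2] being absorbed by the squared difference quotients. *)
Definition energy (r : R) n f : R := r * energy1 n f + energy1 n (flip f) / r.

Lemma energy_ge0 r n f : 0 < r -> 0 <= energy r n f.
Proof.
move=> /ltW r0; apply: addr_ge0; first by apply: mulr_ge0 => //; exact: energy1_ge0.
by apply: divr_ge0 => //; exact: energy1_ge0.
Qed.

Lemma box_count_step (r : R) n v t d : 0 < r -> 0 < d ->
  (forall j, v 0%N j <= t) -> (forall i, v i 0%N <= t) ->
  d ^+ 2 * box_count n v (t + d) <=
    box_count n v t * energy r n (fun i j => trunc t d (v i j)).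
Proof.
move=> r0 d0 v0 v0'; have d0' := ltW d0.
set f := fun i j => trunc t d (v i j).
have h1 : d ^+ 2 * box_count n v (t + d) <= \sum_(i < n.+1) \sum_(j < n.+1) f i j ^+ 2.
  rewrite /box_count mulr_sumr; apply: ler_sum => i _; rewrite mulr_sumr.
  apply: ler_sum => j _; case: (leP (t + d) (v i j)) => h /=; last by rewrite ?mulr0n mulr0 sqr_ge0.
  rewrite ?mulr1n mulr1 lerXn2r ?nnegrE //; first exact: trunc_ge0.
  by rewrite /f /trunc le_min lexx andbT le_max lerBrDr addrC h.
apply: (le_trans h1); apply: (le_trans (gagliardo_box _ _ _)).
- by move=> j; apply: trunc_eq0.
- by move=> i; apply: trunc_eq0.
set P := energy1 n f; set Q := energy1 n (flip f).
set a := box_count n v t.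
have hP : var1 n f ^+ 2 <= (2 * a) * P by exact: var1_trunc.
have hQ : var1 n (flip f) ^+ 2 <= (2 * a) * Q.
  by have := @var1_trunc n (flip v) t d d0'; rewrite box_count_flip.
have a0 : 0 <= a by exact: box_count_ge0.
have P0 : 0 <= P by exact: energy1_ge0.
have Q0 : 0 <= Q by exact: energy1_ge0.
have E0 := @energy_ge0 r n f r0.
rewrite -(@ler_pXn2r _ 2) ?nnegrE ?mulr_ge0 ?var1_ge0 //.
rewrite exprMn; apply: (@le_trans _ _ (((2 * a) * P) * ((2 * a) * Q))).
  by apply: ler_pM => //; rewrite sqr_ge0.
(* The weights [r] and [1 / r] cancel in the product, and [4 x y <= (x + y)^2] absorbs both factors
   2. *)
have -> : 2 * a * P * (2 * a * Q) = a ^+ 2 * (4 * ((r * P) * (Q / r))).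
  by field; rewrite gt_eqF.
rewrite exprMn; apply: ler_wpM2l; first exact: sqr_ge0.
rewrite /energy -/P -/Q; have := sqr_ge0 (r * P - Q / r); lra.
Qed.

Lemma sum_energy1_trunc n v s d k : 0 <= d ->
  \sum_(m < k) energy1 n (fun i j => trunc (s + m%:R * d) d (v i j)) <= energy1 n v.
Proof.
move=> d0; rewrite /energy1 exchange_big /=; apply: ler_sum => i _.
by rewrite exchange_big /=; apply: ler_sum => j _; exact: sum_trunc_lip.
Qed.

Lemma sum_energy_trunc r n v s d k : 0 < r -> 0 <= d ->
  \sum_(m < k) energy r n (fun i j => trunc (s + m%:R * d) d (v i j)) <= energy r n v.
Proof.
move=> r0 d0; rewrite /energy big_split /= -mulr_sumr -mulr_suml; apply: lerD.
  by apply: ler_wpM2l; [exact: ltW|exact: sum_energy1_trunc].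
apply: ler_wpM2r; first by rewrite invr_ge0 ltW.
exact: (@sum_energy1_trunc n (flip v)).
Qed.

(** With [d = s / k.+1], AM-GM bounds the product of the energies by [k.+1^-1 ^+ k.+1]; dividing by
    [(d ^+ 2) ^+ k.+1] leaves [k.+1 / s ^+ 2] per slice. *)
Lemma box_count_double r n v s k : 0 < r -> 0 < s ->
  (forall j, v 0%N j <= s) -> (forall i, v i 0%N <= s) ->
  energy r n v <= 1 ->
  box_count n v (2 * s) <= box_count n v s * (k.+1%:R / s ^+ 2) ^+ k.+1.
Proof.
move=> r0 s0 v0 v0' E1.
set d := s / k.+1%:R; have d0 : 0 < d by rewrite divr_gt0.
pose Em (m : nat) := energy r n (fun i j => trunc (s + m%:R * d) d (v i j)).
have Em0 m : 0 <= Em m by exact: energy_ge0.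
have step m : (d ^+ 2) ^+ m * box_count n v (s + m%:R * d) <=
    box_count n v s * \prod_(l < m) Em l.
  elim: m => [|m IH]; first by rewrite big_ord0 expr0 mul1r mulr1 mul0r addr0.
  have sm : s <= s + m%:R * d by rewrite lerDl mulr_ge0 // ltW.
  have := @box_count_step r n v (s + m%:R * d) d r0 d0.
  move=> /(_ (fun j => le_trans (v0 j) sm) (fun i => le_trans (v0' i) sm)).
  rewrite -addrA -[X in m%:R * d + X]mul1r -mulrDl natr1 -/(Em m) => h.
  rewrite exprSr -mulrA big_ord_recr /= [leRHS]mulrA.
  apply: (@le_trans _ _ ((d ^+ 2) ^+ m * (box_count n v (s + m%:R * d) * Em m))).
    by apply: ler_wpM2l => //; rewrite exprn_ge0 // sqr_ge0.
  by rewrite mulrA; apply: ler_wpM2r.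
have := step k.+1.
have -> : s + k.+1%:R * d = 2 * s by rewrite /d mulrC divfK ?pnatr_eq0 // mulr_natl mulr2n.
have AG : \prod_(l < k.+1) Em l <= (k.+1%:R ^-1) ^+ k.+1.
  have := (@leif_AGM R 'I_k.+1 predT (fun l => Em l) (fun l _ => Em0 l)).1.
  rewrite cardT size_enum_ord => /le_trans; apply.
  rewrite lerXn2r ?nnegrE ?mulr_ge0 ?sumr_ge0 ?invr_ge0 //.
  rewrite -[leRHS]mul1r; apply: ler_wpM2r; first by rewrite invr_ge0.
  apply: le_trans E1; exact: (@sum_energy_trunc r n v s d k.+1 r0 (ltW d0)).
move=> h.
rewrite -(@ler_pM2l _ ((d ^+ 2) ^+ k.+1)) ?exprn_gt0 //.
apply: (le_trans h).
rewrite mulrCA; apply: ler_wpM2l; first exact: box_count_ge0.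
apply: (le_trans AG); rewrite -exprMn.
rewrite le_eqVlt; apply/orP; left; apply/eqP; congr (_ ^+ _).
rewrite /d; have : (k.+1%:R : R) != 0 by rewrite pnatr_eq0.
by move: (k.+1%:R : R) => K K0; field; rewrite K0 gt_eqF.
Qed.

(** * Exponential sums over dyadic layers *)

Lemma expR_sub1_le_double (x : R) : 0 <= x -> x <= 2^-1 -> expR x - 1 <= 2 * x.
Proof.
move=> x0 x2.
(* This gives both [expR x <= 2] and [expR x - 1 <= x * expR x]. *)
have h : expR x * (1 - x) <= 1.
  rewrite -[leRHS](expRxMexpNx_1 x); apply: ler_wpM2l; first exact: expR_ge0.
  exact: expR_ge1Dx.
have e0 := expR_ge0 x.
nra.
Qed.

Lemma expR1_le4 : expR 1 <= 4 :> R.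
Proof.
have := @expR_sub1_le_double 2^-1; rewrite invr_ge0 ler0n lexx => /(_ erefl erefl) h.
have -> : (1 : R) = 2^-1 + 2^-1 by lra.
rewrite expRD; have := expR_ge0 (2^-1 : R); nra.
Qed.

(** Below 8 the exponent is at most [64 / 256], so the linear bound applies. On the layer from
    [8 * 2^m] to [16 * 2^m] the exponent is at most [256 * 4^m / c], which is at most [4^m] because
    [c >= 256]. *)
Lemma expR_layers (c x : R) L : 256 <= c -> 0 <= x -> x < 8 * 2 ^+ L ->
  expR (x ^+ 2 / c) - 1 <=
  x ^+ 2 / 128 + \sum_(m < L) ((8 * 2 ^+ m <= x)%R)%:R * expR (4 ^+ m).
Proof.
move=> c256 x0; have c0 : 0 < c by lra.
elim: L => [|L IH].
  rewrite expr0 mulr1 big_ord0 addr0 => x8.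
  have h : x ^+ 2 / c <= x ^+ 2 / 256.
    by apply: ler_wpM2l; [exact: sqr_ge0 | rewrite lef_pV2 ?posrE].
  have x64 : x ^+ 2 <= 64 by nra.
  apply: (le_trans (expR_sub1_le_double _ _)); last by lra.
    by rewrite divr_ge0 ?sqr_ge0 // ltW.
  by lra.
rewrite big_ord_recr /= => xL.
have [xL'|xL'] := ltP x (8 * 2 ^+ L).
  by rewrite mul0r addr0; exact: IH.
rewrite mul1r addrA; apply: ler_wpDl.
  apply: addr_ge0; first by rewrite divr_ge0 ?sqr_ge0.
  by apply: sumr_ge0 => m _; rewrite mulr_ge0 ?expR_ge0 ?ler0n.
rewrite lerBlDr; apply: ler_wpDr => //; rewrite ler_expR ler_pdivrMr //.
apply: (@le_trans _ _ (4 ^+ L * 256)); last by apply: ler_wpM2l.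
have -> : (4 : R) ^+ L * 256 = (8 * 2 ^+ L.+1) ^+ 2.
  rewrite exprMn -exprM mulnC exprM (_ : 2 ^+ 2 = 4 :> R); last by ring.
  by rewrite (exprS 4 L); ring.
by rewrite lerXn2r ?nnegrE ?mulr_ge0 ?exprn_ge0 // ltW.
Qed.

Lemma box_chebyshev n v t : 0 < t ->
  t ^+ 2 * box_count n v t <= \sum_(i < n.+1) \sum_(j < n.+1) v i j ^+ 2.
Proof.
move=> t0; rewrite /box_count mulr_sumr; apply: ler_sum => i _; rewrite mulr_sumr.
apply: ler_sum => j _; case: (leP t (v i j)) => h /=.
  by rewrite mulr1 lerXn2r ?nnegrE ?(le_trans (ltW t0) h) ?(ltW t0).
by rewrite mulr0 sqr_ge0.
Qed.

(* A layer [8 * 2^m <= v < 16 * 2^m] contributes at most [2^-m / 16]. *)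
Lemma box_trudinger r (H c : R) n v : 0 < r -> 0 < H -> 256 <= c ->
  (forall i j, 0 <= v i j) ->
  (forall j, v 0%N j <= 4) -> (forall i, v i 0%N <= 4) ->
  (\sum_(i < n.+1) \sum_(j < n.+1) v i j ^+ 2) * H <= 1 -> energy r n v <= 1 ->
  (\sum_(i < n.+1) \sum_(j < n.+1) (expR (v i j ^+ 2 / c) - 1)) * H <= 1.
Proof.
move=> r0 H0 c256 v0 vb vb' vL2 vE.
(* The box is finite, so finitely many layers cover all values of [v]. *)
pose L := (\max_(p : 'I_n.+1 * 'I_n.+1) Num.bound (v p.1 p.2))%N.
have vL (i j : 'I_n.+1) : v i j < 8 * 2 ^+ L.
  apply: (lt_le_trans (archi_boundP (v0 i j))).
  apply: (@le_trans _ _ (2 ^+ L)).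
    rewrite -natrX ler_nat; apply: (@leq_trans L); last exact/ltnW/ltn_expl.
    exact: (@leq_bigmax _ (fun p : 'I_n.+1 * 'I_n.+1 => Num.bound (v p.1 p.2)) (i, j)).
  by rewrite ler_peMl ?exprn_ge0 // ler1n.
have layer m : box_count n v (8 * 2 ^+ m) * expR (4 ^+ m) * H <= 16^-1 * 2^-1 ^+ m.
  set s : R := 4 * 2 ^+ m.
  have p2 : 0 < 2 ^+ m :> R by rewrite exprn_gt0.
  have s4 : 4 <= s by rewrite /s ler_peMr // -natrX ler1n expn_gt0.
  have s0 : 0 < s by lra.
  have kE : (4 ^ m).-1.+1 = (4 ^ m)%N by rewrite prednK // expn_gt0.
  have := @box_count_double r n v s (4 ^ m).-1 r0 s0
    (fun j => le_trans (vb j) s4) (fun i => le_trans (vb' i) s4) vE.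
  have s2 : s ^+ 2 = 16 * 4 ^+ m.
    by rewrite /s exprMn -exprM mulnC exprM; congr (_ * _ ^+ _); ring.
  have q0 : 0 < 4 ^+ m :> R by rewrite exprn_gt0.
  have k16 : (4 ^ m)%:R / (16 * 4 ^+ m) = 16^-1 :> R.
    by rewrite natrX; move: q0; move: (4 ^+ m) => q q0; field; rewrite gt_eqF.
  rewrite kE s2 k16.
  have -> : 2 * s = 8 * 2 ^+ m by rewrite /s; ring.
  move=> hd.
  have hc := @box_chebyshev n v s s0; rewrite s2 in hc.
  set N8 := box_count n v (8 * 2 ^+ m) in hd *.
  set N4 := box_count n v s in hd hc.
  have N40 : 0 <= N4 by exact: box_count_ge0.
  (* Doubling from [s] gains [16^-1 ^+ (4 ^ m)], since [4^m / s^2 = 1 / 16]; this beats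
     [expR (4 ^+ m)] because [e <= 4 < 16]. *)
  have he : expR (4 ^+ m) * 16^-1 ^+ (4 ^ m) <= 1 :> R.
    rewrite -natrX -[_%:R]mulr1 expRM_natl -exprMn; apply: exprn_ile1.
      by rewrite mulr_ge0 ?expR_ge0.
    have := expR1_le4; lra.
  have h1 : N8 * expR (4 ^+ m) <= N4.
    apply: (@le_trans _ _ (N4 * (expR (4 ^+ m) * 16^-1 ^+ (4 ^ m)))).
      by rewrite [X in N4 * X]mulrC mulrA; apply: ler_wpM2r => //; exact: expR_ge0.
    by rewrite ler_piMr.
  (* Chebyshev at level [s], where [s^2 = 16 * 4^m]. *)
  have h2 : N4 * H <= 16^-1 * (4 ^+ m)^-1.
    rewrite -invfM -[leRHS]mul1r ler_pdivlMr ?mulr_gt0 //.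
    apply: le_trans vL2; rewrite mulrAC; apply: ler_wpM2r; first exact: ltW.
    by rewrite mulrC.
  apply: (le_trans (ler_wpM2r (ltW H0) h1)); apply: (le_trans h2).
  apply: ler_wpM2l => //; rewrite exprVn lef_pV2 ?posrE //.
  by rewrite lerXn2r ?nnegrE // ler_nat.
(* All layers together contribute at most [2 / 16], and the quadratic term at most [1 / 128], so the
   total stays below 1. *)
have geo : \sum_(m < L) (2^-1 : R) ^+ m <= 2.
  suff -> : \sum_(m < L) (2^-1 : R) ^+ m = 2 - 2 * 2^-1 ^+ L.
    by rewrite lerBlDr lerDl mulr_ge0 // exprn_ge0.
  elim: (L) => [|l IH]; first by rewrite big_ord0 expr0; ring.
  by rewrite big_ord_recr /= IH exprS; lra.
apply: (@le_trans _ _ ((\sum_(i < n.+1) \sum_(j < n.+1) (v i j ^+ 2 / 128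
    + \sum_(m < L) ((8 * 2 ^+ m <= v i j)%R)%:R * expR (4 ^+ m))) * H)).
  apply: ler_wpM2r; first exact: ltW.
  by apply: ler_sum => i _; apply: ler_sum => j _; apply: expR_layers.
have -> : \sum_(i < n.+1) \sum_(j < n.+1) (v i j ^+ 2 / 128
    + \sum_(m < L) ((8 * 2 ^+ m <= v i j)%R)%:R * expR (4 ^+ m)) =
  (\sum_(i < n.+1) \sum_(j < n.+1) v i j ^+ 2) / 128 +
  \sum_(m < L) box_count n v (8 * 2 ^+ m) * expR (4 ^+ m).
  under eq_bigr do rewrite big_split /=.
  rewrite big_split /=; congr (_ + _).
    by rewrite mulr_suml; apply: eq_bigr => i _; rewrite mulr_suml.
  under eq_bigr do rewrite exchange_big /=.
  rewrite exchange_big /=; apply: eq_bigr => m _; rewrite /box_count mulr_suml.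
  by apply: eq_bigr => i _; rewrite mulr_suml.
rewrite mulrDl mulrAC [X in _ + X]mulr_suml.
have : \sum_(m < L) box_count n v (8 * 2 ^+ m) * expR (4 ^+ m) * H <=
       \sum_(m < L) 16^-1 * 2^-1 ^+ m by apply: ler_sum => m _; exact: layer.
rewrite -mulr_sumr; lra.
Qed.

End Box.

(** * Lattice sums and their exhaustion by boxes *)

Section GridSums.
Variable R : realType.
Implicit Types (f g : int * int -> R) (r s : seq (int * int)).

Lemma le_sum_gsum f r : uniq r -> (forall z, 0 <= f z) ->
  ((\sum_(z <- r) f z)%:E <= gsum f)%E.
Proof.
move=> ur f0; apply: esum_ge; exists [set` r]; first by split => //; exact: finite_seq.
by rewrite -fsbig_seq // sumEFin.
Qed.

Lemma gsum_le f (c : R) : (forall r, uniq r -> \sum_(z <- r) f z <= c) ->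
  (gsum f <= c%:E)%E.
Proof.
move=> fc; apply: ge_ereal_sup => _ [X [finX _] <-].
by rewrite fsbig_finite // sumEFin lee_fin; apply: fc; exact: finmap.fset_uniq.
Qed.

Lemma gsum_ge0 f : (forall z, 0 <= f z) -> (0 <= gsum f)%E.
Proof. by move=> f0; apply: esum_ge0 => z _; rewrite lee_fin. Qed.

Lemma ler_sum_subseq f r s : uniq r -> uniq s -> {subset r <= s} ->
  (forall z, 0 <= f z) -> \sum_(z <- r) f z <= \sum_(z <- s) f z.
Proof.
move=> ur us rs f0; rewrite [leRHS](bigID (mem r)) /=.
have -> : \sum_(z <- r) f z = \sum_(z <- s | z \in r) f z.
  rewrite -[RHS]big_filter; apply: perm_big; apply: uniq_perm => //.
    exact: filter_uniq.
  by move=> z; rewrite mem_filter; case: (boolP (z \in r)) => // /rs ->.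
by rewrite lerDl sumr_ge0.
Qed.

Lemma le_sum_inj_gsum (I : finType) (e : I -> int * int) f : injective e ->
  (forall z, 0 <= f z) -> ((\sum_i f (e i))%:E <= gsum f)%E.
Proof.
move=> einj f0; have := @le_sum_gsum f (map e (enum I)).
rewrite map_inj_uniq // enum_uniq big_map big_enum; exact.
Qed.

Lemma gsum_le_mul f g (K c : R) : 0 <= K -> (forall z, 0 <= g z) ->
  (forall z, f z <= K * g z) -> (gsum g <= c%:E)%E -> (gsum f <= (K * c)%:E)%E.
Proof.
move=> K0 g0 fg gc; apply: gsum_le => r ur.
apply: (@le_trans _ _ (\sum_(z <- r) K * g z)); first by apply: ler_sum.
rewrite -mulr_sumr; apply: ler_wpM2l => //; rewrite -lee_fin.
by apply: le_trans gc; exact: le_sum_gsum.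
Qed.

(** An infinite superlevel set would contain more than [c / e] points, each contributing at least
    [e]. *)
Lemma finite_superlevel f (c e : R) : (forall z, 0 <= f z) -> (gsum f <= c%:E)%E ->
  0 < e -> finite_set [set z | e <= f z].
Proof.
move=> f0 fc e0; apply: contrapT => inf.
have [B Be Bn] := infinite_set_fset (Num.bound (c / e)) inf.
have c0 : 0 <= c by rewrite -lee_fin; exact: le_trans (gsum_ge0 f0) fc.
have : \sum_(z <- finmap.enum_fset B) f z <= c.
  by rewrite -lee_fin; apply: le_trans fc; apply: le_sum_gsum f0; exact: finmap.fset_uniq.
apply/negP; rewrite -ltNge.
apply: (@lt_le_trans _ _ (\sum_(z <- finmap.enum_fset B) e)); last first.
  by rewrite big_seq [leRHS]big_seq; apply: ler_sum => z zB; exact: Be.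
rewrite big_const_seq count_predT iter_addr_0 -mulr_natr mulrC -ltr_pdivrMr //.
apply: (lt_le_trans (archi_boundP _)); first by rewrite divr_ge0 // ltW.
by rewrite ler_nat.
Qed.

Lemma finite_set_box (S : set (int * int)) : finite_set S ->
  exists M : nat, forall z, S z -> (`|z.1| < M)%N /\ (`|z.2| < M)%N.
Proof.
move=> /finite_fsetP[F ->].
exists (\max_(z <- finmap.enum_fset F) maxn `|z.1|%N `|z.2|%N).+1 => z /= zF.
have := @leq_bigmax_seq _ (finmap.enum_fset F) xpredT (fun z : int * int => maxn `|z.1|%N `|z.2|%N) z zF isT.
by rewrite geq_max => /andP[].
Qed.

(** The shift by [M] puts the faces [i = 0] and [j = 0] at coordinate [-M], just outside the region
    where both coordinates are below [M] in absolute value. *)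
Definition box_point (M : nat) (i j : nat) : int * int := (i%:Z - M%:Z, j%:Z - M%:Z).

Lemma box_point_inj M a b :
  injective (fun p : 'I_a * 'I_b => box_point M p.1 p.2).
Proof.
move=> [i j] [i' j'] [] /= /addIr[ii] /addIr[jj].
by congr pair; apply: val_inj.
Qed.

Lemma box_pointS1 M i j : box_point M i.+1 j = ((box_point M i j).1 + 1, (box_point M i j).2).
Proof. by rewrite /box_point /=; congr pair; lia. Qed.

Lemma box_pointS2 M i j : box_point M i j.+1 = ((box_point M i j).1, (box_point M i j).2 + 1).
Proof. by rewrite /box_point /=; congr pair; lia. Qed.

Lemma box_point_surj M z : (`|z.1| < M)%N -> (`|z.2| < M)%N ->
  exists p : 'I_(M + M).+1 * 'I_(M + M).+1, z = box_point M p.1 p.2.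
Proof.
case: z => a b /= aM bM.
have ha : (`|(a + M%:Z)%R| < (M + M).+1)%N by lia.
have hb : (`|(b + M%:Z)%R| < (M + M).+1)%N by lia.
exists (Ordinal ha, Ordinal hb); rewrite /box_point /=; congr pair; lia.
Qed.

Lemma box_point_boundary M i j : i = 0%N \/ j = 0%N ->
  ~ ((`|(box_point M i j).1| < M)%N /\ (`|(box_point M i j).2| < M)%N).
Proof. by rewrite /box_point /=; case=> ->; lia. Qed.

End GridSums.

(** * Transfer from boxes to the grid *)

Section Grid.
Variables (R : realType) (h1 h2 : R).
Hypotheses (hh1 : 0 < h1) (hh2 : 0 < h2).
Implicit Types u : int * int -> R.

Let hvol_gt0 : 0 < hvol h1 h2.
Proof. exact: mulr_gt0. Qed.

Lemma sqr_hvol_ge0 u z : 0 <= u z ^+ 2 * hvol h1 h2.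
Proof. by rewrite mulr_ge0 ?sqr_ge0 // ltW. Qed.

Lemma W12norm_ge0 u : 0 <= W12norm h1 h2 u.
Proof. exact: sqrtr_ge0. Qed.

(** A finite sum of three nonnegative extended reals has finite terms, so [fine] loses nothing
    here. *)
Lemma W12norm_sqr u : inW12 h1 h2 u -> exists a b c : R,
  [/\ gsum (fun z => u z ^+ 2 * hvol h1 h2) = a%:E,
      gsum (fun z => D1p h1 u z ^+ 2 * hvol h1 h2) = b%:E,
      gsum (fun z => D2p h2 u z ^+ 2 * hvol h1 h2) = c%:E &
      W12norm h1 h2 u ^+ 2 = a + b + c].
Proof.
rewrite /inW12 /W12norm /W12sq.
have := gsum_ge0 (sqr_hvol_ge0 u).
have := gsum_ge0 (sqr_hvol_ge0 (D1p h1 u)).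
have := gsum_ge0 (sqr_hvol_ge0 (D2p h2 u)).
case: (gsum _) => [c| |] //; case: (gsum _) => [b| |] //; case: (gsum _) => [a| |] //.
rewrite !lee_fin => c0 b0 a0 _; exists a, b, c; split => //.
by rewrite /= sqr_sqrtr // !addr_ge0.
Qed.

Lemma W12norm_gt0 u : inW12 h1 h2 u -> u <> (fun=> 0) -> 0 < W12norm h1 h2 u.
Proof.
move=> uW u0.
have [z uz] : exists z, u z <> 0.
  by apply/existsNP => H; apply: u0; apply/funext.
have [a [b [c [ha hb hc N2]]]] := W12norm_sqr uW.
have b0 : 0 <= b by rewrite -lee_fin -hb; exact: gsum_ge0 (sqr_hvol_ge0 _).
have c0 : 0 <= c by rewrite -lee_fin -hc; exact: gsum_ge0 (sqr_hvol_ge0 _).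
have a0 : 0 < a.
  rewrite -lte_fin -ha; have := @le_sum_gsum R _ [:: z] isT (sqr_hvol_ge0 u).
  apply: lt_le_trans; rewrite big_seq1 lte_fin mulr_gt0 // exprn_even_gt0 //.
  exact/eqP.
have : 0 < W12norm h1 h2 u ^+ 2 by rewrite N2; lra.
by rewrite exprn_even_gt0 //= lt_def => ->; rewrite W12norm_ge0.
Qed.

Lemma ler_sqr_abs_diff (x y N : R) : 0 < N ->
  (`|x| / N - `|y| / N) ^+ 2 <= (x - y) ^+ 2 / N ^+ 2.
Proof.
move=> N0; rewrite -mulrBl exprMn exprVn; apply: ler_wpM2r.
  by rewrite invr_ge0 sqr_ge0.
rewrite -[leLHS]real_normK ?num_real // -[leRHS]real_normK ?num_real //.
by rewrite lerXn2r ?nnegrE // ler_dist_dist.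
Qed.

(** It suffices to bound finite partial sums. Each is enclosed in a box that also surrounds the
    finite set where the normalised function is at least 4, which makes [box_trudinger]
    applicable. *)
Lemma grid_trudinger u (c : R) : inW12 h1 h2 u -> u <> (fun=> 0) -> 256 <= c ->
  (gsum (fun z => ((expR ((`|u z| / W12norm h1 h2 u) ^+ 2 / c) - 1) * hvol h1 h2)%R) <= 1)%E.
Proof.
move=> uW u0 c256; have N0 := W12norm_gt0 uW u0.
have [A [B [C [hA hB hC]]]] := W12norm_sqr uW.
move: N0; set N := W12norm h1 h2 u => N0 N2.
set H := hvol h1 h2 in hA hB hC *; have H0 : 0 < H := hvol_gt0.
have A0 : 0 <= A by rewrite -lee_fin -hA; exact: gsum_ge0 (sqr_hvol_ge0 _).
have B0 : 0 <= B by rewrite -lee_fin -hB; exact: gsum_ge0 (sqr_hvol_ge0 _).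
have C0 : 0 <= C by rewrite -lee_fin -hC; exact: gsum_ge0 (sqr_hvol_ge0 _).
have N20 : 0 < N ^+ 2 by rewrite exprn_gt0.
pose w z := `|u z| / N.
have w0 z : 0 <= w z by rewrite divr_ge0 // ltW.
have c0 : 0 < c by lra.
(* On this set [u z ^+ 2 * H] is at least [16 * N ^+ 2 * H], while its total sum is [A]. *)
have finw : finite_set [set z | 4 <= w z].
  have := @finite_superlevel R (fun z => u z ^+ 2 * H) A (16 * N ^+ 2 * H).
  rewrite hA lexx => /(_ (sqr_hvol_ge0 u) isT).
  rewrite !mulr_gt0 // => /(_ isT); apply: sub_finite_set => z /=.
  rewrite /w ler_pdivlMr // => h; rewrite ler_pM2r //.
  rewrite -[leRHS]real_normK ?num_real //; nra.
apply: gsum_le => l ul.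
have [M HM] : exists M : nat, forall z, ([set z | 4 <= w z] `|` [set` l]) z ->
    (`|z.1| < M)%N /\ (`|z.2| < M)%N.
  by apply: finite_set_box; rewrite finite_setU; split => //; exact: finite_seq.
pose n := (M + M)%N.
pose v i j := w (box_point M i j).
have v4 i j : i = 0%N \/ j = 0%N -> v i j <= 4.
  move=> ij; rewrite leNgt; apply/negP => /ltW h.
  exact: (box_point_boundary ij) (HM _ (or_introl h)).
have vL2 : (\sum_(i < n.+1) \sum_(j < n.+1) v i j ^+ 2) * H <= A / N ^+ 2.
  rewrite ler_pdivlMr //.
  have := @le_sum_inj_gsum R _ _ _ (@box_point_inj M n.+1 n.+1) (sqr_hvol_ge0 u).
  rewrite -/H hA lee_fin; apply: le_trans.
  rewrite pair_bigA /= !mulr_suml; apply: ler_sum => p _.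
  rewrite /v /w exprMn exprVn real_normK ?num_real //.
  by rewrite mulrAC divfK ?gt_eqF // ?(gt_eqF N20).
(* The cell volume [h1 * h2] divided by [h1 ^+ 2] yields the weight [h2 / h1]; the second direction
   yields its inverse. *)
have vE1 : h2 / h1 * energy1 n v <= B / N ^+ 2.
  rewrite ler_pdivlMr //.
  have := @le_sum_inj_gsum R _ _ _ (@box_point_inj M n n.+1) (sqr_hvol_ge0 (D1p h1 u)).
  rewrite -/H hB lee_fin; apply: le_trans.
  rewrite /energy1 pair_bigA /= mulr_sumr mulr_suml; apply: ler_sum => p _.
  rewrite /v /w /D1p box_pointS1.
  set x := u (_, _); set y := u _.
  have -> : ((x - y) / h1) ^+ 2 * H = h2 / h1 * ((x - y) ^+ 2 / N ^+ 2) * N ^+ 2.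
    by rewrite /H /hvol; field; rewrite !gt_eqF.
  apply: ler_wpM2r; first exact: ltW.
  apply: ler_wpM2l; first by rewrite divr_ge0 // ltW.
  exact: ler_sqr_abs_diff.
have vE2 : energy1 n (flip v) / (h2 / h1) <= C / N ^+ 2.
  rewrite ler_pdivlMr //.
  have inj : injective (fun p : 'I_n * 'I_n.+1 => box_point M p.2 p.1).
    by move=> [i j] [i' j'] /= /(@box_point_inj M n.+1 n (j, i) (j', i'))[-> ->].
  have := @le_sum_inj_gsum R _ _ _ inj (sqr_hvol_ge0 (D2p h2 u)).
  rewrite -/H hC lee_fin; apply: le_trans.
  rewrite /energy1 pair_bigA /= !mulr_suml; apply: ler_sum => p _.
  rewrite /flip /v /w /D2p box_pointS2.
  set x := u (_, _); set y := u _.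
  have -> : ((x - y) / h2) ^+ 2 * H = ((x - y) ^+ 2 / N ^+ 2) / (h2 / h1) * N ^+ 2.
    by rewrite /H /hvol; field; rewrite !gt_eqF.
  apply: ler_wpM2r; first exact: ltW.
  apply: ler_wpM2r; first by rewrite invr_ge0 divr_ge0 // ltW.
  exact: ler_sqr_abs_diff.
(* The normalised parts are nonnegative with sum 1, so the [L^2] part and the energy are each at
   most 1. *)
have sumN : A / N ^+ 2 + B / N ^+ 2 + C / N ^+ 2 = 1.
  by rewrite -!mulrDl -N2 divff // gt_eqF.
have [A' B' C'] : [/\ 0 <= A / N ^+ 2, 0 <= B / N ^+ 2 & 0 <= C / N ^+ 2].
  by split; rewrite divr_ge0 // ltW.
have := @box_trudinger R (h2 / h1) H c n v (divr_gt0 hh2 hh1) H0 c256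
  (fun i j => w0 _) (fun j => v4 _ _ (or_introl erefl)) (fun i => v4 _ _ (or_intror erefl)).
have -> : (\sum_(i < n.+1) \sum_(j < n.+1) v i j ^+ 2) * H <= 1 by lra.
have -> : energy (h2 / h1) n v <= 1 by rewrite /energy; lra.
move=> /(_ isT isT); apply: le_trans.
pose G z := (expR (w z ^+ 2 / c) - 1) * H.
have G0 z : 0 <= G z.
  rewrite mulr_ge0 ?(ltW H0) // subr_ge0 -expR0 ler_expR divr_ge0 ?sqr_ge0 //.
  exact: ltW.
pose e (p : 'I_n.+1 * 'I_n.+1) := box_point M p.1 p.2.
have einj : injective e by exact: box_point_inj.
have le1 : \sum_(z <- l) G z <= \sum_(z <- map e (enum {: 'I_n.+1 * 'I_n.+1})) G z.
  apply: ler_sum_subseq => //.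
    by rewrite map_inj_uniq // enum_uniq.
  move=> z zl; have [h1' h2'] := HM z (or_intror zl).
  have [p ->] := box_point_surj h1' h2'.
  by apply: map_f; rewrite mem_enum.
apply: (le_trans le1).
by rewrite big_map big_enum pair_bigA mulr_suml.
Qed.

End Grid.

(** * Powers against the exponential, and the constant *)

Lemma powR_le_Aexp (R : realType) (w p : R) : 0 <= w -> 2 <= p ->
  w `^ p <= (2 * p) `^ p * Aexp w.
Proof.
move=> w0 p2; have p0 : 0 <= p by lra.
have wE (x : R) : x ^+ 2 <= Aexp x by rewrite /Aexp lerBrDl; exact: expR_ge1Dx.
have [->|wn0] := eqVneq w 0.
  rewrite powR0; last by apply/eqP; lra.
  by apply: mulr_ge0; [exact: powR_ge0 | exact: le_trans (sqr_ge0 _) (wE _)].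
have wp : 0 < w by rewrite lt_def wn0.
have [w1|w1] := leP w 1.
  have h : w `^ p <= w ^+ 2.
    by rewrite -powR_mulrn //; apply: ger_powR => //; rewrite wp w1.
  apply: (le_trans h); apply: (le_trans (wE _)).
  apply: ler_peMl; first exact: le_trans (sqr_ge0 _) (wE _).
  have : powR 1 p <= powR (2 * p) p.
    by apply: ge0_ler_powR; rewrite ?nnegrE //; lra.
  by rewrite powR1.
have -> : w = 2 * p * (w / (2 * p)) by field; lra.
rewrite powRM; [|lra|by rewrite divr_ge0 //; lra].
have -> : 2 * p * (w / (2 * p)) = w by field; lra.
apply: ler_wpM2l; first exact: powR_ge0.
set y := w / (2 * p).
have y0 : 0 <= y by rewrite divr_ge0 //; lra.
(* With [w = 2 p y] it remains to bound [y^p] by [Aexp w]; raising this inequality to the power [p]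
   gives the exponent [w / 2 - p]. *)
have yE : y <= expR (y - 1) by have := expR_ge1Dx (y - 1); lra.
have h : y `^ p <= expR (w / 2 - p).
  have -> : w / 2 - p = (y - 1) * p by rewrite /y; field; lra.
  by rewrite expRM; apply: ge0_ler_powR; rewrite ?nnegrE ?expR_ge0.
apply: (le_trans h).
have w2 : 1 <= w ^+ 2 by nra.
have hY : expR (w / 2 - p) <= expR (w ^+ 2 - 1) by rewrite ler_expR; nra.
have hX := expR_ge1Dx (w ^+ 2 - 1).
have hW : expR (w ^+ 2 - 1) * expR 1 = expR (w ^+ 2) by rewrite -expRD subrK.
(* Put [E = expR (w ^+ 2 - 1)], which is at least 1. Then [e >= 2] gives
   [expR (w ^+ 2) - 1 >= 2 E - 1 >= E]. *)
have e2 : 0 <= expR 1 - 2 :> R by have := expR_ge1Dx (1 : R); lra.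
have := mulr_ge0 (expR_ge0 (w ^+ 2 - 1)) e2.
rewrite mulrBr hW /Aexp; lra.
Qed.

(** Allows [c = CS2 ^+ 2] in [grid_trudinger]; [pi >= 2] already makes the square at least
    [64 * 4 * 256]. *)
Lemma CS2_sqr_ge (R : realType) : 256 <= (CS2 : R) ^+ 2.
Proof.
have pi2 := pi_ge2 R; have e0 := expR_ge0 (1 : R).
rewrite /CS2 exprMn sqr_sqrtr; last by apply: mulr_ge0; lra.
nra.
Qed.

Lemma CS2_gt0 (R : realType) : 0 < (CS2 : R).
Proof.
have pi2 := pi_ge2 R; have e0 := expR_ge0 (1 : R).
by rewrite /CS2 mulr_gt0 // sqrtr_gt0; apply: mulr_gt0; lra.
Qed.

(** * Orlicz and [L^p] bounds on the grid *)

Lemma gsum_Aexp_le1 (R : realType) (h1 h2 : R) (u : int * int -> R) :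
  0 < h1 -> 0 < h2 -> inW12 h1 h2 u -> u <> (fun=> 0) ->
  (gsum (fun z => (Aexp (`|u z| / (CS2 * W12norm h1 h2 u)) * hvol h1 h2)%R) <= 1)%E.
Proof.
move=> hh1 hh2 uW u0.
have := grid_trudinger hh1 hh2 uW u0 (CS2_sqr_ge R).
congr (gsum _ <= _)%E; apply/funext => z; rewrite /Aexp.
by congr ((expR _ - 1) * _); rewrite -expr_div_n -mulrA -invfM [CS2 * _]mulrC.
Qed.

Lemma orlicz_norm0 (R : realType) (h1 h2 : R) :
  (orlicz_norm h1 h2 Aexp (fun=> 0%R) <= 0)%E.
Proof.
apply/lee_addgt0Pr => e e0; rewrite add0e.
apply: ereal_inf_lbound; exists e => //; split=> //.
apply: (@le_trans _ _ 0%E) => //; apply: gsum_le => r _.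
by rewrite big1 // => z _; rewrite normr0 mul0r /Aexp expr0n expR0 subrr mul0r.
Qed.

Lemma Lpnorm0 (R : realType) (h1 h2 p : R) : 2 <= p ->
  Lpnorm h1 h2 p (fun=> 0) = 0%E.
Proof.
move=> p2; rewrite /Lpnorm /gsum esum1 => [|z _].
  by rewrite poweR0r // invr_eq0; apply/eqP; lra.
by rewrite normr0 powR0 ?mul0r //; apply/eqP; lra.
Qed.

(** [powR_le_Aexp] at [w = |u z| / (CS2 * N)], scaled by [(CS2 * N)^p], is summed against the
    exponential bound; a [p]-th root concludes. *)
Lemma Lpnorm_le (R : realType) (h1 h2 p : R) (u : int * int -> R) :
  0 < h1 -> 0 < h2 -> inW12 h1 h2 u -> u <> (fun=> 0) -> 2 <= p ->
  (Lpnorm h1 h2 p u <= (2 * CS2 * p * W12norm h1 h2 u)%:E)%E.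
Proof.
move=> hh1 hh2 uW u0 p2; set N := W12norm h1 h2 u.
have N0 : 0 < N := W12norm_gt0 hh1 hh2 uW u0.
have C0 := CS2_gt0 R; have CN0 : 0 < CS2 * N by rewrite mulr_gt0.
have H0 : 0 <= hvol h1 h2 by rewrite mulr_ge0 // ltW.
have K0 : 0 <= 2 * CS2 * p * N by rewrite !mulr_ge0 ?(ltW C0) ?(ltW N0) //; lra.
have A0 z : 0 <= Aexp (`|u z| / (CS2 * N)).
  by rewrite /Aexp subr_ge0 -expR0 ler_expR sqr_ge0.
have : (gsum (fun z => powR `|u z| p * hvol h1 h2)%R <=
        (powR (2 * CS2 * p * N) p * 1)%:E)%E.
  have Aexp_le1 := gsum_Aexp_le1 hh1 hh2 uW u0.
  apply: (@gsum_le_mul R _ _ _ 1 _ _ _ Aexp_le1); first exact: powR_ge0.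
    by move=> z; rewrite mulr_ge0.
  move=> z; rewrite mulrA; apply: ler_wpM2r => //.
  have -> : `|u z| = (CS2 * N) * (`|u z| / (CS2 * N)).
    by rewrite mulrC divfK // gt_eqF.
  have w0 : 0 <= `|u z| / (CS2 * N) by rewrite divr_ge0 // ltW.
  rewrite powRM ?(ltW CN0) //.
  have -> : CS2 * N * (`|u z| / (CS2 * N)) = `|u z| by rewrite mulrC divfK // gt_eqF.
  have -> : 2 * CS2 * p * N = (CS2 * N) * (2 * p) by ring.
  rewrite [leRHS](_ : _ = (CS2 * N) `^ p * ((2 * p) `^ p * Aexp (`|u z| / (CS2 * N)))).
    by apply: ler_wpM2l; [exact: powR_ge0 | exact: powR_le_Aexp].
  by rewrite powRM ?(ltW CN0) ?mulrA //; lra.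
have : (0 <= gsum (fun z => powR `|u z| p * hvol h1 h2)%R)%E.
  by apply: gsum_ge0 => z; rewrite mulr_ge0 ?powR_ge0.
rewrite /Lpnorm mulr1; case: (gsum _) => [x| |] //; rewrite !lee_fin => x0 xK.
apply: (@le_trans _ _ (((2 * CS2 * p * N) `^ p) `^ p^-1)).
  by apply: ge0_ler_powR; rewrite ?nnegrE ?powR_ge0 // invr_ge0; lra.
by rewrite -powRrM divff ?powRr1 //; apply/eqP; lra.
Qed.

Theorem mainTheorem7 (R : realType) (h1 h2 : R) (hh1 : 0 < h1) (hh2 : 0 < h2) :
  (forall u : int * int -> R, inW12 h1 h2 u ->
     (orlicz_norm h1 h2 Aexp u <= (CS2 * W12norm h1 h2 u)%:E)%E)
  /\
  (forall u : int * int -> R, inW12 h1 h2 u -> u <> (fun _ => 0) ->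
     (gsum (fun z => (Aexp (`|u z| / (CS2 * W12norm h1 h2 u)) * hvol h1 h2)%R) <= 1)%E)
  /\
  (forall (u : int * int -> R) (p : R), inW12 h1 h2 u -> 2 <= p ->
     (Lpnorm h1 h2 p u <= (2 * CS2 * p * W12norm h1 h2 u)%:E)%E).
Proof.
have C0 := CS2_gt0 R.
split; [move=> u uW | split; [move=> u uW u0 | move=> u p uW p2]].
- have N0 := W12norm_ge0 h1 h2 u.
  (* For [u = 0] the candidate [CS2 * W12norm h1 h2 u] is 0 and so not admissible in the infimum;
     arbitrarily small positive values serve instead. *)
  have [u0|u0] := pselect (u = (fun=> 0)).
    rewrite [X in orlicz_norm _ _ _ X]u0; apply: le_trans (orlicz_norm0 _ _) _.
    by rewrite lee_fin mulr_ge0 // ltW.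
  apply: ereal_inf_lbound; exists (CS2 * W12norm h1 h2 u) => //; split.
    by rewrite mulr_gt0 // W12norm_gt0.
  exact: gsum_Aexp_le1.
- exact: gsum_Aexp_le1.
- have [u0|u0] := pselect (u = (fun=> 0)).
    rewrite [X in Lpnorm _ _ _ X]u0 Lpnorm0 // lee_fin.
    by rewrite !mulr_ge0 ?W12norm_ge0 ?(ltW C0) //; lra.
  exact: Lpnorm_le.
Qed.
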